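(* Let $M$ be a 7-dimensional manifold with a $G_2$ structure $\varphi$, let $\xi$ be a unit vector field on $M$, and let $(\phi,\xi,\eta,g)$ be the almost contact metric structure obtained from $\varphi$ and $\xi$, with fundamental 2-form $\Phi$. (a) If $\nabla_{\xi}\xi\neq 0$ (i.e. $\nabla_\xi\xi$ is not identically zero), then $\nabla\Phi$ does not belong to any of the classes $\mathcal{D}_2,\mathcal{C}_1,\mathcal{C}_2,\ldots,\mathcal{C}_{11}$. (b) If $\operatorname{div}(\xi)\neq 0$ (i.e. $\operatorname{div}(\xi)$ is not identically zero), then the almost contact metric structure does not belong to any of the classes $\mathcal{D}_1$ and $\mathcal{C}_i$ for $i=1,2,3,4,6,7,8,9,10,11,12$, and it is not semi-cosymplectic, i.e. it does not belong to the class $\mathcal{C}_1\oplus\mathcal{C}_2\oplus\mathcal{C}_3\oplus\mathcal{C}_7\oplus\mathcal{C}_8\oplus\mathcal{C}_9\oplus\mathcal{C}_{10}\oplus\mathcal{C}_{11}$.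
   Context: **$G_2$ structures.** On $\mathbb{R}^7$ with dual basis $e^1,\dots,e^7$ put $\varphi_0=e^{123}+e^{145}+e^{167}+e^{246}-e^{257}-e^{347}-e^{356}$, where $e^{ijk}=e^i\wedge e^j\wedge e^k$. A $G_2$ structure on an oriented 7-manifold $M$ is a global 3-form $\varphi$ such that for each $p\in M$ there is a linear isomorphism $T_pM\cong\mathbb{R}^7$ carrying $\varphi_p$ to $\varphi_0$. It determines a Riemannian metric $g$ and an orientation (those of $\mathbb{R}^7$ under such isomorphisms) and a 2-fold vector cross product $\times$ defined by $\varphi(x,y,z)=g(x\times y,z)$. $\nabla$ is the Levi-Civita connection of $g$. **Induced almost contact metric structure.** For a unit vector field $\xi$ on $M$ put $\phi(x)=\xi\times x$, $\eta(x)=g(\xi,x)$. Then $(\phi,\xi,\eta,g)$ is an almost contact metric structure: $\phi^2=-I+\eta\otimes\xi$, $\eta(\xi)=1$, $g(\phi x,\phi y)=g(x,y)-\eta(x)\eta(y)$. Its fundamental 2-form is $\Phi(x,y)=g(x,\phi y)$, and $\nabla\Phi$ is regarded as the $(0,3)$-tensor $(x,y,z)\mapsto(\nabla_x\Phi)(y,z)$. **Classes (Chinea–Gonzalez).** At each $p\in M$ let $\mathcal{C}$ be the space of trilinear forms $\alpha$ on $T_pM$ with $\alpha(x,y,z)=-\alpha(x,z,y)=-\alpha(x,\phi y,\phi z)+\eta(y)\alpha(x,\xi,z)+\eta(z)\alpha(x,y,\xi)$ for all $x,y,z$; then $(\nabla\Phi)_p\in\mathcal{C}$. Let $\{e_i\}$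 be an orthonormal basis of $T_pM$. All identities below are for all $x,y,z\in T_pM$. - $\mathcal{D}_1=\{\alpha\in\mathcal{C}:\alpha(\xi,x,y)=\alpha(x,\xi,y)=0\}$. - $\mathcal{D}_2=\{\alpha\in\mathcal{C}:\alpha(x,y,z)=\eta(x)\alpha(\xi,y,z)+\eta(y)\alpha(x,\xi,z)+\eta(z)\alpha(x,y,\xi)\}$. - $\mathcal{C}_1=\{\alpha\in\mathcal{D}_1:\alpha(x,x,y)=0\}$. - $\mathcal{C}_2=\{\alpha\in\mathcal{D}_1:\alpha(x,y,z)+\alpha(y,z,x)+\alpha(z,x,y)=0\}$. - $\mathcal{C}_3=\{\alpha\in\mathcal{D}_1:\alpha(x,y,z)=\alpha(\phi x,\phi y,z),\ \sum_i\alpha(e_i,e_i,z)=0\}$. - $\mathcal{C}_4$: all $\alpha$ of the form $\alpha(x,y,z)=g(\phi x,\phi y)\theta(z)-g(\phi x,\phi z)\theta(y)-\Phi(x,y)\theta(\phi z)+\Phi(x,z)\theta(\phi y)$ for some linear form $\theta$ with $\theta(\xi)=0$. - $\mathcal{C}_5$: all $\alpha(x,y,z)=c\,(\Phi(x,z)\eta(y)-\Phi(x,y)\eta(z))$, $c\in\mathbb{R}$. - $\mathcal{C}_6$: all $\alpha(x,y,z)=c\,(g(x,z)\eta(y)-g(x,y)\eta(z))$, $c\in\mathbb{R}$. - $\mathcal{C}_7,\dots,\mathcal{C}_{10}$: all $\alpha(x,y,z)=\eta(z)\beta(x,y)-\eta(y)\beta(x,z)$, where $\beta$ is a bilinear form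 with $\beta(\xi,\cdot)=\beta(\cdot,\xi)=0$ and, respectively: ($\mathcal{C}_7$) $\beta$ symmetric, $\beta(\phi x,\phi y)=\beta(x,y)$, $\sum_i\beta(e_i,e_i)=0$; ($\mathcal{C}_8$) $\beta$ antisymmetric, $\beta(\phi x,\phi y)=\beta(x,y)$, $\sum_i\beta(e_i,\phi e_i)=0$; ($\mathcal{C}_9$) $\beta$ symmetric, $\beta(\phi x,\phi y)=-\beta(x,y)$; ($\mathcal{C}_{10}$) $\beta$ antisymmetric, $\beta(\phi x,\phi y)=-\beta(x,y)$. - $\mathcal{C}_{11}=\{\alpha\in\mathcal{C}:\alpha(x,y,z)=-\eta(x)\alpha(\xi,\phi y,\phi z)\}$. - $\mathcal{C}_{12}=\{\alpha\in\mathcal{C}:\alpha(x,y,z)=\eta(x)\eta(y)\alpha(\xi,\xi,z)+\eta(x)\eta(z)\alpha(\xi,y,\xi)\}$. One has $\mathcal{D}_1=\mathcal{C}_1\oplus\cdots\oplus\mathcal{C}_4$, $\mathcal{D}_2=\mathcal{C}_5\oplus\cdots\oplus\mathcal{C}_{11}$, $\mathcal{C}=\mathcal{D}_1\oplus\mathcal{D}_2\oplus\mathcal{C}_{12}$. The structure (equivalently $\nabla\Phi$) belongs to the class given by one of these subspaces, or by a direct sum of them, if $(\nabla\Phi)_p$ lies in that subspace for every $p\in M$. *)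

(* Defs.v *)
From HB Require Import structures.
From mathcomp Require Import all_boot all_order all_algebra.
From mathcomp Require Import all_classical all_reals all_analysis.
Set Implicit Arguments.
Unset Strict Implicit.
Unset Printing Implicit Defensive.
Import Order.TTheory GRing.Theory Num.Theory numFieldNormedType.Exports.
Local Open Scope classical_set_scope.
Local Open Scope ring_scope.

Section Smooth.
Context {R : realType} {m : nat}.

Definition partials (s : seq 'I_m) (f : 'rV[R]_m -> R) : 'rV[R]_m -> R :=
  foldr (fun i (h : 'rV[R]_m -> R^o) x => 'D_(delta_mx 0 i) h x) f s.

(* C^oo is asked on a whole neighbourhood of [x]: there, all iterated partial
   derivatives exist and are Frechet differentiable, hence continuous. *)
Definition smooth_near (f : 'rV[R]_m -> R) (x : 'rV[R]_m) : Prop :=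
  \forall y \near x, forall s : seq 'I_m, differentiable (partials s f : _ -> R^o) y.

End Smooth.

Section Manifolds.

(* [cmap] and [cinv] are only meaningful on [cdom] and on its image. *)
Record chart (R : realType) (m : nat) (M : topologicalType) := Chart {
  cdom : set M;
  cmap : M -> 'rV[R]_m;
  cinv : 'rV[R]_m -> M;
  cdom_open : open cdom;
  cimg_open : open (cmap @` cdom);
  cmapK : {in cdom, cancel cmap cinv};
  cmap_continuous : {in cdom, continuous cmap};
  cinv_continuous : {in cmap @` cdom, continuous cinv} }.

Record manifold (R : realType) (m : nat) := Manifold {
  msort :> topologicalType;
  m_hausdorff : hausdorff_space msort;
  m_countable : @second_countable msort;
  atlas : set (chart R m msort);
  chart_at : msort -> chart R m msort;
  chart_at_atlas : forall p, atlas (chart_at p);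
  chart_at_dom : forall p, cdom (chart_at p) p;
  transition_smooth : forall c d, atlas c -> atlas d ->
    forall p, cdom c p -> cdom d p ->
    forall i, smooth_near (fun x => cmap d (cinv c x) 0 i) (cmap c p) }.

End Manifolds.

Section Tangent.
Context {R : realType} {n : nat} {M : manifold R n.+1}.
Implicit Types (p q : M) (c d : chart R n.+1 M).

(* A tangent vector at [p] is given by its components in the preferred chart
   [chart_at M p]; [change c d p v] converts components from [c] to [d]. *)
Definition tangent p : vectType R := 'rV[R]_n.+1.

Definition change c d p (v : 'rV[R]_n.+1) : 'rV[R]_n.+1 :=
  v *m 'J (cmap d \o cinv c) (cmap c p).

Definition smooth_fun (f : M -> R) p : Prop :=
  smooth_near (f \o cinv (chart_at p)) (cmap (chart_at p) p).

(* The derivative [v(f)] of a function in the direction of [v]. *)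
Definition dir p (v : tangent p) (f : M -> R) : R :=
  'D_(v : 'rV[R]_n.+1) (f \o cinv (chart_at p) : _ -> R^o) (cmap (chart_at p) p).

Definition vfield := forall p, tangent p.

(* [smooth_vf X p]: the vector field [X] is smooth near [p]; away from [p] it may
   be arbitrary, so such an [X] stands for a local section of the tangent bundle. *)
Definition smooth_vf (X : vfield) p : Prop :=
  forall i, smooth_fun
    (fun q => change (chart_at q) (chart_at p) q (X q) 0 i) p.

(* The field with the constant components of [v] in the chart at [p]. *)
Definition extend p (v : tangent p) : vfield :=
  fun q => change (chart_at p) (chart_at q) q v.

Definition field2 := forall p, tangent p -> tangent p -> R.
Definition field3 := forall p, tangent p -> tangent p -> tangent p -> R.

Definition smooth_field3 (om : field3) : Prop :=
  forall p X Y Z, smooth_vf X p -> smooth_vf Y p -> smooth_vf Z p ->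
    smooth_fun (fun q => om q (X q) (Y q) (Z q)) p.

(* [nabla p x Y] is [nabla_x Y] at [p], meaningful when [Y] is smooth near [p]. *)
Definition cov_deriv := forall p, tangent p -> vfield -> tangent p.

Record connection (nabla : cov_deriv) : Prop := Connection {
  conn_linear : forall p (a : R) (x y : tangent p) Z, smooth_vf Z p ->
    nabla p (a *: x + y) Z = a *: nabla p x Z + nabla p y Z;
  conn_add : forall p (x : tangent p) Y Z, smooth_vf Y p -> smooth_vf Z p ->
    nabla p x (fun q => Y q + Z q) = nabla p x Y + nabla p x Z;
  conn_leibniz : forall p (x : tangent p) f Y, smooth_fun f p -> smooth_vf Y p ->
    nabla p x (fun q => f q *: Y q) = dir x f *: Y p + f p *: nabla p x Y;
  conn_smooth : forall p X Y, smooth_vf X p -> smooth_vf Y p ->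
    smooth_vf (fun q => nabla q (X q) Y) p }.

(* Torsion-freeness [nabla_X Y - nabla_Y X = [X, Y]] is expressed through the action
   of the Lie bracket on functions, [[X, Y] f = X (Y f) - Y (X f)]. *)
Definition torsion_free (nabla : cov_deriv) : Prop :=
  forall p X Y f, smooth_vf X p -> smooth_vf Y p -> smooth_fun f p ->
    dir (nabla p (X p) Y - nabla p (Y p) X) f =
    dir (X p) (fun q => dir (Y q) f) - dir (Y p) (fun q => dir (X q) f).

Definition metric_connection (g : field2) (nabla : cov_deriv) : Prop :=
  forall p (x : tangent p) Y Z, smooth_vf Y p -> smooth_vf Z p ->
    dir x (fun q => g q (Y q) (Z q)) =
    g p (nabla p x Y) (Z p) + g p (Y p) (nabla p x Z).

Definition levi_civita (g : field2) (nabla : cov_deriv) : Prop :=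
  [/\ connection nabla, torsion_free nabla & metric_connection g nabla].

Definition divergence (nabla : cov_deriv) (X : vfield) p : R :=
  \tr (lin1_mx (fun x : 'rV[R]_n.+1 => nabla p x X : 'rV[R]_n.+1)).

(* [(nabla_x om)(y, z)]; by tensoriality it does not depend on the choice of the local
   extensions of [y] and [z], taken here with constant components in a chart. *)
Definition nabla_field2 (nabla : cov_deriv) (om : field2) : field3 :=
  fun p x y z =>
    dir x (fun q => om q (extend y q) (extend z q))
    - om p (nabla p x (extend y)) z - om p y (nabla p x (extend z)).

End Tangent.
Arguments vfield {R n} M.
Arguments field2 {R n} M.
Arguments field3 {R n} M.
Arguments cov_deriv {R n} M.
Arguments nabla_field2 {R n M} nabla om p.

Section Multilinear.
Context {R : realType} {V : vectType R}.

Definition bilinear_form (b : V -> V -> R) : Prop :=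
  (forall x, scalar (b x)) /\ (forall y, scalar (fun x => b x y)).

Definition trilinear_form (a : V -> V -> V -> R) : Prop :=
  [/\ forall x y, scalar (fun z => a x y z),
      forall x z, scalar (fun y => a x y z) &
      forall y z, scalar (fun x => a x y z)].

Definition orthonormal_basis (g : V -> V -> R) (e : seq V) : Prop :=
  basis_of fullv e /\
  forall i j, (i < size e)%N -> (j < size e)%N -> g e`_i e`_j = (i == j)%:R.

End Multilinear.

Section ChineaGonzalez.
Context {R : realType} {V : vectType R}.

Record acm := Acm {
  acm_phi : V -> V;
  acm_xi : V;
  acm_eta : V -> R;
  acm_g : V -> V -> R }.

Variable S : acm.
Local Notation ph := (acm_phi S).
Local Notation xi := (acm_xi S).
Local Notation eta := (acm_eta S).
Local Notation g := (acm_g S).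

Definition fundamental_form (x y : V) : R := g x (ph y).
Local Notation Phi := fundamental_form.

Definition C_space : set (V -> V -> V -> R) := [set a | trilinear_form a /\
  forall x y z, a x y z = - a x z y /\
    a x y z = - a x (ph y) (ph z) + eta y * a x xi z + eta z * a x y xi].

Definition D1 : set (V -> V -> V -> R) := [set a | C_space a /\
  forall x y, a xi x y = 0 /\ a x xi y = 0].

Definition D2 : set (V -> V -> V -> R) := [set a | C_space a /\
  forall x y z,
    a x y z = eta x * a xi y z + eta y * a x xi z + eta z * a x y xi].

Definition C1 : set (V -> V -> V -> R) := [set a | D1 a /\
  forall x y, a x x y = 0].

Definition C2 : set (V -> V -> V -> R) := [set a | D1 a /\
  forall x y z, a x y z + a y z x + a z x y = 0].

Definition C3 : set (V -> V -> V -> R) := [set a | [/\ D1 a,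
  forall x y z, a x y z = a (ph x) (ph y) z &
  forall e, orthonormal_basis g e -> forall z, \sum_(u <- e) a u u z = 0]].

Definition C4 : set (V -> V -> V -> R) := [set a | exists theta : V -> R,
  [/\ scalar theta, theta xi = 0 &
      forall x y z, a x y z =
        g (ph x) (ph y) * theta z - g (ph x) (ph z) * theta y
        - Phi x y * theta (ph z) + Phi x z * theta (ph y)]].

Definition C5 : set (V -> V -> V -> R) := [set a | exists c : R,
  forall x y z, a x y z = c * (Phi x z * eta y - Phi x y * eta z)].

Definition C6 : set (V -> V -> V -> R) := [set a | exists c : R,
  forall x y z, a x y z = c * (g x z * eta y - g x y * eta z)].

Definition from_bilinear (P : set (V -> V -> R)) : set (V -> V -> V -> R) :=
  [set a | exists b : V -> V -> R,
    [/\ bilinear_form b, forall x, b xi x = 0 /\ b x xi = 0, P b &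
        forall x y z, a x y z = eta z * b x y - eta y * b x z]].

Definition C7 := from_bilinear [set b | [/\ forall x y, b x y = b y x,
  forall x y, b (ph x) (ph y) = b x y &
  forall e, orthonormal_basis g e -> \sum_(u <- e) b u u = 0]].

Definition C8 := from_bilinear [set b | [/\ forall x y, b x y = - b y x,
  forall x y, b (ph x) (ph y) = b x y &
  forall e, orthonormal_basis g e -> \sum_(u <- e) b u (ph u) = 0]].

Definition C9 := from_bilinear [set b |
  (forall x y, b x y = b y x) /\ (forall x y, b (ph x) (ph y) = - b x y)].

Definition C10 := from_bilinear [set b |
  (forall x y, b x y = - b y x) /\ (forall x y, b (ph x) (ph y) = - b x y)].

Definition C11 : set (V -> V -> V -> R) := [set a | C_space a /\
  forall x y z, a x y z = - (eta x * a xi (ph y) (ph z))].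

Definition C12 : set (V -> V -> V -> R) := [set a | C_space a /\
  forall x y z,
    a x y z = eta x * eta y * a xi xi z + eta x * eta z * a xi y xi].

(* Only the indices 1, ..., 12 are meaningful. *)
Definition CG (i : nat) : set (V -> V -> V -> R) :=
  nth set0 [:: set0; C1; C2; C3; C4; C5; C6; C7; C8; C9; C10; C11; C12] i.

Definition CG_sum (s : seq nat) : set (V -> V -> V -> R) :=
  [set a | exists b : nat -> V -> V -> V -> R,
    (forall i, i \in s -> CG i (b i)) /\
    forall x y z, a x y z = \sum_(i <- s) b i x y z].

End ChineaGonzalez.
Arguments acm {R} V.

Section G2.
Context {R : realType}.

Definition covec (i : nat) (x : 'rV[R]_7) : R := x 0 (inord i.-1).

(* [(e^i /\ e^j /\ e^k)(x, y, z)], with indices starting from 1. *)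
Definition wedge3 (i j k : nat) (x y z : 'rV[R]_7) : R :=
  \det (\matrix_(a < 3, b < 3) covec (nth 0%N [:: i; j; k] b) (nth 0 [:: x; y; z] a)).

Definition phi0 (x y z : 'rV[R]_7) : R :=
  wedge3 1 2 3 x y z + wedge3 1 4 5 x y z + wedge3 1 6 7 x y z
  + wedge3 2 4 6 x y z - wedge3 2 5 7 x y z - wedge3 3 4 7 x y z
  - wedge3 3 5 6 x y z.

Context {M : manifold R 7}.
Implicit Types (p : M) (vphi : field3 M) (nabla : cov_deriv M).

Definition adapted vphi p (u : 'Hom(tangent p, 'rV[R]_7)) : Prop :=
  bijective u /\ forall x y z, vphi p x y z = phi0 (u x) (u y) (u z).

(* That each [vphi p] is trilinear and alternating follows from the second clause. *)
Definition g2_structure vphi : Prop :=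
  smooth_field3 vphi /\ forall p, exists u, @adapted vphi p u.

(* Any two adapted isomorphisms differ by an element of G2, which is contained in
   SO(7), so the choice made here does not matter. *)
Definition coframe vphi p : 'Hom(tangent p, 'rV[R]_7) :=
  xget 0 [set u | @adapted vphi p u].

Definition g2_metric vphi : field2 M :=
  fun p x y => \sum_(i < 7) coframe vphi p x 0 i * coframe vphi p y 0 i.
Arguments g2_metric vphi p x y : clear implicits.

(* The unique [w] such that [vphi p x y z = g (w, z)] for all [z]. *)
Definition cross vphi p (x y : tangent p) : tangent p :=
  xget 0 [set w | forall z, vphi p x y z = g2_metric vphi p w z].
Arguments cross vphi p x y : clear implicits.

Definition g2_acm vphi (xi : vfield M) p : acm (tangent p) :=
  Acm (cross vphi p (xi p)) (xi p) (g2_metric vphi p (xi p)) (g2_metric vphi p).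

Definition unit_vfield vphi (xi : vfield M) : Prop :=
  (forall p, smooth_vf xi p) /\ forall p, g2_metric vphi p (xi p) (xi p) = 1.

Definition acm_in_class vphi (xi : vfield M) nabla
    (K : forall p, acm (tangent p) ->
           set (tangent p -> tangent p -> tangent p -> R)) : Prop :=
  forall p, K p (g2_acm vphi xi p)
    (nabla_field2 nabla (fun q => fundamental_form (g2_acm vphi xi q)) p).

End G2.

(* Main.v *)
Require Import Defs.
From HB Require Import structures.
From mathcomp Require Import all_boot all_order all_algebra.
From mathcomp Require Import all_classical all_reals all_analysis.
From mathcomp Require Import ring lra.
Import Order.TTheory GRing.Theory Num.Theory numFieldNormedType.Exports.
Local Open Scope classical_set_scope.
Local Open Scope ring_scope.

Set Implicit Arguments.
Unset Strict Implicit.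
Unset Printing Implicit Defensive.

(** Everything follows from one formula for the tensor [a = nabla Phi]:
    [a(x, xi, z) = - vphi(xi, z, nabla_x xi)] ([nablaPhi_reeb]).  Indeed
    [Phi(y, z) = vphi(xi, z, y)], so for a fixed local field [Z] the quantity
    [a(x, y, z)] is, up to a term that vanishes for [y = xi], the covariant
    derivative of the 1-form [L = vphi(xi, Z, .)].  A covariant derivative of a
    1-form is tensorial in its last argument ([nabla_form_tensorial]), so at the
    point considered the constant extension of [xi] may be replaced by the field
    [xi] itself, and there [L(xi)] is identically zero; what remains is
    [- L(nabla_x xi)].  Working with [vphi], which is smooth by hypothesis,
    instead of [g] and [cross] avoids proving that these are smooth.

    Since [g(xi, xi) = 1] and [nabla] is metric, [nabla_x xi] is orthogonal to
    [xi] ([nabla_orthogonal]).  With [phi^2 = - id + eta (x) xi] the formula gives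
    two invariants of [a]:
    - the form [a(xi, xi, .)] determines [nabla_xi xi] ([reeb_geodesic]);
    - the trace [sum_u a(u, xi, phi u)] over an orthonormal basis is [div xi]
      ([reeb_trace_divergence]).
    What is left is algebra in one tangent space: the first invariant vanishes on
    [D_2] and on [C_1, ..., C_11] ([D2_reeb], [CG_reeb]), and the second one, being
    linear in [a], vanishes on [D_1], on every [C_i] with [i <> 5] and hence on sums
    of these ([D1_trace], [CG_trace], [CG_sum_trace]).  That the structure is almost
    contact metric comes down to the polynomial identity
    [x * (x * y) = - |x|^2 y + <x, y> x] for the cross product of R^7
    ([cross0_sqr]). *)

(** * Linear forms and local calculus *)

(** Gives access to the theory of linear maps for a map only known to be linear. *)
Lemma scalar_linear (R : comPzRingType) (V : lmodType R) (L : V -> R) :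
  scalar L -> exists f : {scalar V}, L = f.
Proof.
move=> linL; pose lL := GRing.isLinear.Build R V R _ L linL.
pose f : {scalar V} := HB.pack L lL.
by exists f.
Qed.

Section LocalCalculus.
Context {R : realType}.

Lemma near_eq_diff (V W : normedModType R) (f g : V -> W) (x : V) :
  (\near x, f x = g x) -> differentiable f x ->
  differentiable g x /\ 'd g x = 'd f x :> (V -> W).
Proof.
move=> fg df; have fgx : f x = g x := nbhs_singleton fg.
have [dfc fE] := (diff_locallyP _ _).1 df.
have gE : g \o shift x = cst (g x) + 'd f x +o_ 0 id.
  apply/eqaddoP => _/posnumP[e].
  have /eqaddoP/(_ _ (gt0 e)) fo := fE.
  have fgs : \forall h \near 0, f (h + x) = g (h + x).
    by move: fg; rewrite (near_shift 0 x); apply: filterS => h /=; rewrite subr0.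
  by apply: filterS2 fgs fo => h /= Eh; rewrite !fctE /= -Eh -fgx.
have dgE : 'd g x = 'd f x :> (V -> W) by apply/diff_unique.
have dg : differentiable g x by apply/diff_locallyP; split; rewrite dgE.
exact: (conj dg dgE).
Qed.

Lemma differentiable_rV (V : normedModType R) m (f : V -> 'rV[R]_m) (x : V) :
  (forall i, differentiable (fun y => f y 0 i : R^o) x) -> differentiable f x.
Proof.
move=> df.
have -> : f = \sum_(i < m) (fun y => (f y 0 i : R^o) *: (delta_mx 0 i : 'rV[R]_m)).
  by apply/funext => y; rewrite fct_sumE; exact: row_sum_delta.
apply: differentiable_sum => i; apply: (@differentiableZl _ _ _ (fun y => f y 0 i)).
exact: df.
Qed.

Section SmoothNear.
Context {m : nat}.
Implicit Types (f g : 'rV[R]_m -> R) (x : 'rV[R]_m).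

(** Equality near a point is equality near all nearby points, which lets the
    induction on the length of [s] go through. *)
Lemma near_eq_partials s f g x : (\near x, f x = g x) ->
  \forall y \near x, partials s f y = partials s g y.
Proof.
move=> fg; elim: s => [//|i s /near_join IH] /=.
by apply: filterS IH => y; exact: near_eq_derive.
Qed.

Lemma near_eq_smooth f g x :
  (\near x, f x = g x) -> smooth_near f x -> smooth_near g x.
Proof.
move=> /near_join fg sf; apply: filterS2 fg sf => y fg sf s.
by have [] := near_eq_diff (near_eq_partials s fg) (sf s).
Qed.

Lemma smooth_cst (c : R) x : smooth_near (fun=> c) x.
Proof.
apply: filterE => y s.
have [d ->] : exists d, partials s (fun=> c) = (fun=> d) :> ('rV[R]_m -> R).
  elim: s c => [|i s IH] c; first by exists c.
  have [d E] := IH c; exists 0 => /=; apply/funext => z.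
  by have /= -> := E; exact: derive_cst.
exact: differentiable_cst.
Qed.

Lemma partialsD s f g x : smooth_near f x -> smooth_near g x ->
  \forall y \near x,
    partials s (fun z => f z + g z) y = partials s f y + partials s g y.
Proof.
move=> sf sg; elim: s => [|i s /near_join IH] /=; first exact: filterE.
near=> y.
rewrite (near_eq_derive _ (near IH y _))// [LHS]deriveD//.
- exact/diff_derivable/(near sf y).
- exact/diff_derivable/(near sg y).
Unshelve. all: by end_near. Qed.

Lemma smooth_add f g x :
  smooth_near f x -> smooth_near g x -> smooth_near (fun y => f y + g y) x.
Proof.
move=> /near_join sf /near_join sg.
apply: filterS2 sf sg => y sf sg s.
have Es : \forall z \near y,
    partials s f z + partials s g z = partials s (fun y => f y + g y) z.
  by apply: filterS (partialsD s sf sg) => z ->.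
have df := nbhs_singleton sf s; have dg := nbhs_singleton sg s.
by have [] := near_eq_diff Es (differentiableD df dg).
Qed.

Lemma smooth_near_diff f x : smooth_near f x -> differentiable (f : _ -> R^o) x.
Proof. by move=> /nbhs_singleton /(_ [::]). Qed.

End SmoothNear.
End LocalCalculus.

(** * Transition maps of charts *)

Section Charts.
Context {R : realType} {n : nat} {M : manifold R n.+1}.
Implicit Types (p q : M) (c d : chart R n.+1 M).

Lemma near_chart c p (P : M -> Prop) : cdom c p ->
  (\forall q \near p, P q) -> \forall x \near cmap c p, P (cinv c x).
Proof.
move=> cp Pp; have ip : cmap c p \in cmap c @` cdom c by rewrite inE; exists p.
have := cinv_continuous ip; apply; rewrite cmapK ?inE//.
Qed.

Lemma near_chart_image c p : cdom c p ->
  \forall x \near cmap c p, (cmap c @` cdom c) x.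
Proof. by move=> cp; apply: open_nbhs_nbhs; split; [exact: cimg_open|exists p]. Qed.

Lemma transition_diff c d p : atlas c -> atlas d -> cdom c p -> cdom d p ->
  differentiable (cmap d \o cinv c) (cmap c p).
Proof.
move=> ac ad cp dp; apply: differentiable_rV => i.
exact/smooth_near_diff/transition_smooth.
Qed.

(** The chain rule: the two transition maps are inverse to each other near the
    image of [p], so the product of their Jacobians is the identity. *)
Lemma change_inv c d p (v : 'rV[R]_n.+1) : atlas c -> atlas d ->
  cdom c p -> cdom d p -> change d c p (change c d p v) = v.
Proof.
move=> ac ad cp dp; rewrite /change /jacobian !mul_rV_lin1.
have ddc := transition_diff ac ad cp dp.
have dcd := transition_diff ad ac dp cp.
have Ep : (cmap d \o cinv c) (cmap c p) = cmap d p by rewrite /= cmapK ?inE.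
suff : 'd (cmap c \o cinv d) ((cmap d \o cinv c) (cmap c p))
          ('d (cmap d \o cinv c) (cmap c p) v) = v by rewrite Ep.
rewrite -[LHS]/(('d _ _ \o 'd _ _) v) -diff_comp; [|exact: ddc|by rewrite Ep].
have Eid : \forall x \near cmap c p,
    x = ((cmap c \o cinv d) \o (cmap d \o cinv c)) x.
  have dq := near_chart cp (open_nbhs_nbhs (conj (cdom_open d) dp)).
  apply: filterS2 (near_chart_image cp) dq => x [q cq <-] /=.
  by rewrite (cmapK (mem_set cq)) => dq; rewrite !cmapK ?inE.
have [|_ ->] := near_eq_diff Eid; first exact: ex_diff.
by rewrite diff_val.
Qed.

End Charts.

(** * Coordinate frames and tensoriality *)

Section LocalFrames.
Context {R : realType} {n : nat} {M : manifold R n.+1}.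
Implicit Types (p q : M) (X Y : vfield M).

Definition components p X q : 'rV[R]_n.+1 :=
  change (chart_at q) (chart_at p) q (X q).

Definition frame p (i : 'I_n.+1) : vfield M := extend (delta_mx 0 i : tangent p).

Lemma near_cdom p : \forall q \near p, cdom (chart_at p) q.
Proof.
by apply: open_nbhs_nbhs; split; [exact: cdom_open|exact: chart_at_dom].
Qed.

Lemma change_id p (v : 'rV[R]_n.+1) : change (chart_at p) (chart_at p) p v = v.
Proof.
rewrite /change /jacobian mul_rV_lin1.
have Eid : \forall x \near cmap (chart_at p) p,
    x = (cmap (chart_at p) \o cinv (chart_at p)) x.
  apply: filterS (near_chart_image (chart_at_dom p)) => x [q cq <-] /=.
  by rewrite cmapK ?inE.
have [|_ ->] := near_eq_diff Eid; first exact: ex_diff.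
by rewrite diff_val.
Qed.

Lemma components_at p X : components p X p = X p.
Proof. exact: change_id. Qed.

Lemma extend_at p (v : tangent p) : extend v p = v.
Proof. exact: change_id. Qed.

Lemma components_extend p (v : tangent p) :
  \forall q \near p, components p (extend v) q = v.
Proof.
apply: filterS (near_cdom p) => q cq.
by apply: change_inv => //; [exact: chart_at_atlas..|exact: chart_at_dom].
Qed.

Lemma frame_decomposition p X :
  \forall q \near p, X q = \sum_i components p X q 0 i *: frame p i q.
Proof.
apply: filterS (near_cdom p) => q cq.
have E : change (chart_at p) (chart_at q) q (components p X q) = X q.
  by apply: change_inv => //; [exact: chart_at_atlas..|exact: chart_at_dom].
rewrite -[LHS]E {1}[components p X q]row_sum_delta /change mulmx_suml.
by apply: eq_bigr => i _; rewrite -scalemxAl.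
Qed.

Lemma near_eq_smooth_fun (f g : M -> R) p :
  (\near p, f p = g p) -> smooth_fun f p -> smooth_fun g p.
Proof.
by move=> fg; apply: near_eq_smooth; exact: (near_chart (chart_at_dom p) fg).
Qed.

Lemma near_eq_dir (f g : M -> R) p (x : tangent p) :
  (\near p, f p = g p) -> dir x f = dir x g.
Proof.
by move=> fg; apply: near_eq_derive; exact: (near_chart (chart_at_dom p) fg).
Qed.

Lemma smooth_fun_cst (a : R) p : smooth_fun (fun=> a) p.
Proof. exact: smooth_cst. Qed.

Lemma dir_cst (a : R) p (x : tangent p) : dir x (fun=> a) = 0.
Proof. exact: derive_cst. Qed.

Lemma near_eq_smooth_vf X Y p :
  (\near p, X p = Y p) -> smooth_vf X p -> smooth_vf Y p.
Proof.
move=> XY sX i; apply: near_eq_smooth_fun (sX i).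
by apply: filterS XY => q ->.
Qed.

Lemma smooth_vf_add X Y p :
  smooth_vf X p -> smooth_vf Y p -> smooth_vf (fun q => X q + Y q) p.
Proof.
move=> sX sY i; apply: near_eq_smooth_fun (smooth_add (sX i) (sY i)).
by apply: filterE => q; rewrite /= /change mulmxDl mxE.
Qed.

Lemma smooth_vf_sum (I : Type) (r : seq I) (F : I -> vfield M) p :
  (forall i, smooth_vf (F i) p) -> smooth_vf (fun q => \sum_(i <- r) F i q) p.
Proof.
move=> sF; elim: r => [|i r IH].
  move=> j; apply: near_eq_smooth_fun (smooth_fun_cst 0 p).
  by apply: filterE => q; rewrite big_nil /change mul0mx mxE.
apply: near_eq_smooth_vf (smooth_vf_add (sF i) IH).
by apply: filterE => q; rewrite big_cons.
Qed.

Lemma smooth_extend p (v : tangent p) : smooth_vf (extend v) p.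
Proof.
move=> i; apply: near_eq_smooth_fun (smooth_fun_cst (v 0 i) p).
by apply: filterS (components_extend v) => q Eq; rewrite -[in LHS]Eq.
Qed.

Lemma smooth_frame_scale X p i : smooth_vf X p ->
  smooth_vf (fun q => components p X q 0 i *: frame p i q) p.
Proof.
move=> sX j.
have Ej : \forall q \near p, components p X q 0 i * (i == j)%:R =
    change (chart_at q) (chart_at p) q (components p X q 0 i *: frame p i q) 0 j.
  apply: filterS (components_extend (delta_mx 0 i : tangent p)) => q Eq.
  rewrite /change -scalemxAl -[_ *m _]/(components p (frame p i) q) Eq.
  by rewrite [RHS]mxE [X in _ = _ * X]mxE eqxx eq_sym.
apply: near_eq_smooth_fun Ej _; case: eqP => [_|_].
- by apply: near_eq_smooth_fun (sX i); apply: filterE => q; rewrite mulr1.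
- by apply: near_eq_smooth_fun (smooth_fun_cst 0 p); apply: filterE => q; rewrite mulr0.
Qed.

(** The product rule for [L(X) = sum_i X^i L(E_i)], where the [E_i] form the
    coordinate frame at [p]. *)
Lemma dir_frame (L : forall q, tangent q -> R) p (x : tangent p) X :
  (forall q, scalar (L q)) -> (forall i, smooth_fun (fun q => L q (frame p i q)) p) ->
  smooth_vf X p ->
  dir x (fun q => L q (X q)) =
  \sum_i (dir x (fun q => components p X q 0 i) * L p (frame p i p)
          + X p 0 i * dir x (fun q => L q (frame p i q))).
Proof.
move=> linL sL sX.
have LE : \forall q \near p,
    L q (X q) = \sum_i components p X q 0 i * L q (frame p i q).
  apply: filterS (frame_decomposition p X) => q {1}->.
  have [Lq ->] := scalar_linear (linL q); rewrite linear_sum; apply: eq_bigr => i _.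
  by rewrite linearZ.
rewrite (near_eq_dir x LE) /dir.
have dX i := smooth_near_diff (sX i); have dL i := smooth_near_diff (sL i).
set c := cmap _ p.
pose h i := ((fun q => components p X q 0 i) \o cinv (chart_at p) : _ -> R^o).
pose k i := ((fun q => L q (frame p i q)) \o cinv (chart_at p) : _ -> R^o).
rewrite (_ : _ \o _ = \sum_i (h i * k i)); last first.
  by apply/funext => y; rewrite fct_sumE.
have dh i : derivable (h i) c x by exact/diff_derivable/dX.
have dk i : derivable (k i) c x by exact/diff_derivable/dL.
rewrite derive_sum => [|i]; last exact: derivableM.
apply: eq_bigr => i _; rewrite deriveM // addrC [_ *: _]mulrC.
by rewrite /h /k /= cmapK ?inE; [rewrite components_at|exact: chart_at_dom].
Qed.

Section Connection.
Variable nabla : cov_deriv M.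
Arguments nabla : clear implicits.
Hypothesis nablaP : connection nabla.

(** A connection is local: multiply both fields by the indicator function of the
    set where they agree.  Smoothness being a condition near [p] only, this function
    is as good as a bump function, and the Leibniz rule shows that multiplying by
    it does not change the derivative at [p]. *)
Lemma near_eq_nabla p (x : tangent p) X Y :
  smooth_vf X p -> (\near p, X p = Y p) -> nabla p x X = nabla p x Y.
Proof.
move=> sX XY.
pose f q : R := `[< X q = Y q >]%:R.
have f1 : \forall q \near p, 1 = f q.
  by apply: filterS XY => q E; rewrite /f asboolT.
have sf : smooth_fun f p := near_eq_smooth_fun f1 (smooth_fun_cst 1 p).
have nablaf Z : smooth_vf Z p -> nabla p x (fun q => f q *: Z q) = nabla p x Z.
  move=> sZ; rewrite (conn_leibniz nablaP)// -(near_eq_dir x f1) dir_cst.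
  by rewrite -(nbhs_singleton f1) scale0r add0r scale1r.
rewrite -(nablaf X)// -(nablaf Y); last exact: near_eq_smooth_vf XY sX.
congr (nabla p x _); apply/functional_extensionality_dep => q; rewrite /f.
by case: asboolP => [->|_]; rewrite ?scale0r.
Qed.

Lemma nabla_sum p (x : tangent p) (I : Type) (r : seq I) (F : I -> vfield M) :
  (forall i, smooth_vf (F i) p) ->
  nabla p x (fun q => \sum_(i <- r) F i q) = \sum_(i <- r) nabla p x (F i).
Proof.
move=> sF; elim: r => [|i r IH].
  have E : nabla p x (fun q => 0 *: (\sum_(i <- [::]) F i q)) = 0.
    rewrite (conn_leibniz nablaP) ?dir_cst ?scale0r ?addr0//.
    - exact: smooth_fun_cst.
    - exact: smooth_vf_sum.
  rewrite big_nil -[RHS]E; congr (nabla p x _).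
  by apply/functional_extensionality_dep => q; rewrite big_nil scaler0.
rewrite big_cons -IH -(conn_add nablaP)//; last exact: smooth_vf_sum.
congr (nabla p x _).
by apply/functional_extensionality_dep => q; rewrite big_cons.
Qed.

Lemma nabla_frame p (x : tangent p) X : smooth_vf X p ->
  nabla p x X =
  \sum_i (dir x (fun q => components p X q 0 i) *: frame p i p
          + X p 0 i *: nabla p x (frame p i)).
Proof.
move=> sX; rewrite (near_eq_nabla x sX (frame_decomposition p X)).
rewrite nabla_sum => [|i]; last exact: smooth_frame_scale.
apply: eq_bigr => i _; rewrite (conn_leibniz nablaP) ?components_at//.
exact: smooth_extend.
Qed.

(** In a frame, [(nabla_x L)(X)] is [sum_i X^i(p) (nabla_x L)(E_i)]: the terms with
    derivatives of the components [X^i] cancel. *)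
Lemma nabla_form_tensorial (L : forall q, tangent q -> R) p (x : tangent p) X Y :
  (forall q, scalar (L q)) ->
  (forall Z, smooth_vf Z p -> smooth_fun (fun q => L q (Z q)) p) ->
  smooth_vf X p -> smooth_vf Y p -> X p = Y p ->
  dir x (fun q => L q (X q)) - L p (nabla p x X) =
  dir x (fun q => L q (Y q)) - L p (nabla p x Y).
Proof.
move=> linL sL sX sY XYp.
have main Z : smooth_vf Z p -> dir x (fun q => L q (Z q)) - L p (nabla p x Z) =
    \sum_i Z p 0 i * (dir x (fun q => L q (frame p i q)) - L p (nabla p x (frame p i))).
  move=> sZ; rewrite dir_frame// => [|i]; last exact/sL/smooth_extend.
  rewrite nabla_frame//.
  have [Lp ->] := scalar_linear (linL p).
  rewrite linear_sum -sumrB; apply: eq_bigr => i _.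
  by rewrite linearD !linearZ /= opprD addrACA subrr add0r mulrBr.
by rewrite !main// XYp.
Qed.

End Connection.
End LocalFrames.

(** * Bilinear forms and orthonormal bases *)

Section BilinearForm.
Context {R : realType} {V : vectType R} {b : V -> V -> R}.
Hypothesis bP : bilinear_form b.

Lemma bilinDr x y z : b x (y + z) = b x y + b x z.
Proof. by have [f ->] := scalar_linear (bP.1 x); rewrite linearD. Qed.

Lemma bilinZr a x y : b x (a *: y) = a * b x y.
Proof. by have [f ->] := scalar_linear (bP.1 x); rewrite linearZ. Qed.

Lemma bilinNr x y : b x (- y) = - b x y.
Proof. by rewrite -scaleN1r bilinZr mulN1r. Qed.

Lemma bilin0r x : b x 0 = 0.
Proof. by rewrite -(scale0r 0) bilinZr mul0r. Qed.

Lemma bilin_sumr (I : Type) (r : seq I) (F : I -> V) x :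
  b x (\sum_(i <- r) F i) = \sum_(i <- r) b x (F i).
Proof. by have [f ->] := scalar_linear (bP.1 x); rewrite linear_sum. Qed.

End BilinearForm.

Lemma orthonormal_expansion (R : realType) (V : vectType R) (g : V -> V -> R)
    (e : seq V) (x : V) : bilinear_form g -> orthonormal_basis g e ->
  x = \sum_(w <- e) g w x *: w.
Proof.
move=> gP [/andP[/eqP eV _] eO].
have xe : x \in <<in_tuple e>>%VS by rewrite /= eV memvf.
rewrite [LHS](coord_span xe) (big_nth 0) big_mkord; apply: eq_bigr => i _.
congr (_ *: _); rewrite [in RHS](coord_span xe) (bilin_sumr gP) (bigD1 i)//=.
rewrite (bilinZr gP) eO// eqxx mulr1 big1 ?addr0// => j ji.
by rewrite (bilinZr gP) eO// eq_sym [_ == _](negPf ji) mulr0.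
Qed.

Section OrthonormalTrace.
Context {R : realType}.

Lemma orthonormal_is_basis (V : vectType R) (g : V -> V -> R) (e : seq V) :
  bilinear_form g -> size e = \dim {:V} ->
  (forall i j, (i < size e)%N -> (j < size e)%N -> g e`_i e`_j = (i == j)%:R) ->
  orthonormal_basis g e.
Proof.
move=> gP se eO; split=> //; rewrite basisEfree se leqnn subvf !andbT.
apply/(@freeP _ _ _ (in_tuple e)) => k k0 i.
have : g e`_i (\sum_(j < size e) k j *: e`_j) = 0 by rewrite k0 (bilin0r gP).
rewrite (bilin_sumr gP) (bigD1 i)//= (bilinZr gP) eO// eqxx mulr1.
rewrite big1 ?addr0// => j ji.
by rewrite (bilinZr gP) eO// eq_sym [_ == _](negPf ji) mulr0.
Qed.

(** Expanding each vector of the standard basis in [e] shows that the trace may be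
    computed in any orthonormal basis. *)
Lemma trace_orthonormal n (g : 'rV[R]_n -> 'rV[R]_n -> R) e
    (f : 'rV[R]_n -> 'rV[R]_n) : bilinear_form g -> orthonormal_basis g e ->
  linear f -> \tr (lin1_mx f) = \sum_(u <- e) g u (f u).
Proof.
move=> gP eO linf; pose lf := GRing.isLinear.Build R _ _ _ f linf.
pose F : {linear 'rV[R]_n -> 'rV[R]_n} := HB.pack f lf.
transitivity (\sum_i \sum_(u <- e) g u (delta_mx 0 i) * f u 0 i).
  apply: eq_bigr => i _; rewrite mxE.
  rewrite [X in f X](orthonormal_expansion _ gP eO) -[f]/(F : _ -> _) linear_sum summxE.
  by apply: eq_bigr => u _; rewrite linearZ mxE.
rewrite exchange_big; apply: eq_bigr => u _ /=.
rewrite [f u in RHS]row_sum_delta (bilin_sumr gP); apply: eq_bigr => i _.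
by rewrite (bilinZr gP) mulrC.
Qed.

End OrthonormalTrace.

(** * The classes of Chinea and Gonzalez in one tangent space *)

Section AlmostContact.
Context {R : realType} {V : vectType R}.

(** The compatibility [g(phi x, phi y) = g(x, y) - eta(x) eta(y)] enters as the
    skewness of [phi], the form in which it gets used. *)
Record almost_contact_metric (S : acm V) : Prop := AlmostContactMetric {
  acm_bilinear : bilinear_form (acm_g S);
  acm_sym : forall x y, acm_g S x y = acm_g S y x;
  acm_skew : forall x y, acm_g S x (acm_phi S y) = - acm_g S y (acm_phi S x);
  acm_sqr : forall x,
    acm_phi S (acm_phi S x) = - x + acm_eta S x *: acm_xi S;
  acm_phi_reeb : acm_phi S (acm_xi S) = 0;
  acm_dual : forall x, acm_eta S x = acm_g S (acm_xi S) x;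
  acm_unit : acm_eta S (acm_xi S) = 1 }.

Variable S : acm V.
Hypothesis SP : almost_contact_metric S.
Local Notation ph := (acm_phi S).
Local Notation xi := (acm_xi S).
Local Notation eta := (acm_eta S).
Local Notation g := (acm_g S).
Implicit Types (a : V -> V -> V -> R) (e : seq V).

Lemma eta_phi x : eta (ph x) = 0.
Proof.
rewrite (acm_dual SP) (acm_skew SP) (acm_phi_reeb SP).
by rewrite (bilin0r (acm_bilinear SP)) oppr0.
Qed.

Lemma g_phi_reeb x : g x (ph xi) = 0.
Proof. by rewrite (acm_phi_reeb SP) (bilin0r (acm_bilinear SP)). Qed.

Lemma g_phi_diag x : g x (ph x) = 0.
Proof. have := acm_skew SP x x; lra. Qed.

Lemma trilinear0m a x z : trilinear_form a -> a x 0 z = 0.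
Proof.
move=> [_ + _] => /(_ x z) /scalar_linear [f E].
by have /= -> := congr1 (@^~ 0) E; rewrite linear0.
Qed.

Lemma D1_reeb a x y : D1 S a -> a x xi y = 0.
Proof. by case=> _ /(_ x y) []. Qed.

Lemma D2_reeb a z : D2 S a -> a xi xi z = 0.
Proof.
case=> [[_ aC]] aD; have := aD xi xi z; have [+ _] := aC xi xi xi.
by rewrite (acm_unit SP) => /eqP; rewrite -addr_eq0 -mulr2n mulrn_eq0 /= => /eqP ->; lra.
Qed.

Lemma from_bilinear_reeb (P : set (V -> V -> R)) a z :
  from_bilinear S P a -> a xi xi z = 0.
Proof.
case=> b [_ b0 _ ->]; have [-> _] := b0 xi; have [-> _] := b0 z.
by rewrite !mulr0 subr0.
Qed.

Lemma C11_reeb a z : C11 S a -> a xi xi z = 0.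
Proof.
case=> -[aT _] ->; rewrite (acm_phi_reeb SP) trilinear0m //.
by rewrite mulr0 oppr0.
Qed.

Lemma CG_reeb i a z : (1 <= i <= 11)%N -> CG S i a -> a xi xi z = 0.
Proof.
do 12?[case: i => [|i]] => //= _; rewrite /CG /=.
- by case=> /D1_reeb.
- by case=> /D1_reeb.
- by case=> /D1_reeb.
- case=> th [_ th0 ->].
  by rewrite /fundamental_form (acm_skew SP xi z) !g_phi_reeb th0; ring.
- case=> c ->; rewrite /fundamental_form g_phi_reeb -(acm_dual SP) eta_phi.
  by rewrite !mul0r subr0 mulr0.
- by case=> c ->; rewrite -!(acm_dual SP) (acm_unit SP) mulr1 mul1r subrr mulr0.
- exact: from_bilinear_reeb.
- exact: from_bilinear_reeb.
- exact: from_bilinear_reeb.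
- exact: from_bilinear_reeb.
- exact: C11_reeb.
Qed.

(** Equal to [div xi] for [a = nabla Phi]. *)
Definition reeb_trace e a : R := \sum_(u <- e) a u xi (ph u).

Lemma trace_pointwise e a : (forall u, a u xi (ph u) = 0) -> reeb_trace e a = 0.
Proof. by move=> a0; rewrite /reeb_trace big1. Qed.

(** The trace of the product of a symmetric and a skew operator vanishes. *)
Lemma trace_sym_skew e b : bilinear_form b -> (forall x y, b x y = b y x) ->
  orthonormal_basis g e -> \sum_(u <- e) b u (ph u) = 0.
Proof.
move=> bP bs eO.
have E : \sum_(u <- e) b u (ph u) =
    \sum_(u <- e) \sum_(w <- e) g w (ph u) * b u w.
  apply: eq_bigr => u _.
  rewrite [ph u in LHS](orthonormal_expansion _ (acm_bilinear SP) eO).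
  by rewrite (bilin_sumr bP); apply: eq_bigr => w _; rewrite (bilinZr bP).
suff : \sum_(u <- e) b u (ph u) = - \sum_(u <- e) b u (ph u) by lra.
rewrite {1}E exchange_big {}E -sumrN; apply: eq_bigr => u _ /=.
by rewrite -sumrN; apply: eq_bigr => w _; rewrite (acm_skew SP) bs mulNr.
Qed.

(** For [a] built from [b], the value [a(u, xi, phi u)] is [- b(u, phi u)] because
    [eta] vanishes on the image of [phi]. *)
Lemma from_bilinear_trace (P : set (V -> V -> R)) e a :
  (forall b, bilinear_form b -> (forall x, b xi x = 0 /\ b x xi = 0) -> P b ->
    \sum_(u <- e) b u (ph u) = 0) ->
  from_bilinear S P a -> reeb_trace e a = 0.
Proof.
move=> P0 [b [bP b0 Pb aE]].
transitivity (- \sum_(u <- e) b u (ph u)); last by rewrite P0 ?oppr0.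
rewrite -sumrN; apply: eq_bigr => u _.
by rewrite aE eta_phi (acm_unit SP) mul0r mul1r sub0r.
Qed.

(** Both [b(phi x, phi (phi x)) = - b(phi x, x) = b(x, phi x)] by skewness and
    [phi^2 = - id] modulo [xi], and [b(phi x, phi (phi x)) = - b(x, phi x)]. *)
Lemma C10_diag b x : bilinear_form b -> (forall x, b x xi = 0) ->
  (forall x y, b x y = - b y x) -> (forall x y, b (ph x) (ph y) = - b x y) ->
  b x (ph x) = 0.
Proof.
move=> bP b0 bs bphi; have := bphi x (ph x).
by rewrite (acm_sqr SP) (bilinDr bP) (bilinNr bP) (bilinZr bP) b0 (bs (ph x)); lra.
Qed.

(** The sum is [f(phi xi) = 0], as [xi = sum_u eta(u) u]; the skewness of [phi]
    stands in for its linearity. *)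
Lemma C12_trace (f : {scalar V}) e : orthonormal_basis g e ->
  \sum_(u <- e) eta u * f (ph u) = 0.
Proof.
move=> eO; have expand := orthonormal_expansion _ (acm_bilinear SP) eO.
under eq_bigr => u _ do rewrite [ph u]expand linear_sum mulr_sumr.
rewrite exchange_big big1 //= => w _.
transitivity (eta (ph w) * - f w); last by rewrite eta_phi mul0r.
rewrite (acm_dual SP) [ph w in RHS]expand (bilin_sumr (acm_bilinear SP)).
rewrite mulr_suml; apply: eq_bigr => u _.
rewrite linearZ /= (acm_skew SP) (bilinZr (acm_bilinear SP)) -(acm_dual SP); ring.
Qed.

Lemma CG_trace i e a : orthonormal_basis g e ->
  i \in [:: 1; 2; 3; 4; 6; 7; 8; 9; 10; 11; 12]%N ->
  CG S i a -> reeb_trace e a = 0.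
Proof.
move=> eO; do 13?[case: i => [|i]] => //= _; rewrite /CG /=.
- by case=> aD _; apply: trace_pointwise => u; exact: D1_reeb.
- by case=> aD _; apply: trace_pointwise => u; exact: D1_reeb.
- by case=> aD _ _; apply: trace_pointwise => u; exact: D1_reeb.
- case=> th [/scalar_linear[f ->] th0 aE]; apply: trace_pointwise => u.
  by rewrite aE /fundamental_form !g_phi_reeb th0 (acm_phi_reeb SP) linear0; ring.
- case=> c aE; apply: trace_pointwise => u.
  by rewrite aE g_phi_diag eta_phi; ring.
- by apply: from_bilinear_trace => b bP _ [bs _ _]; exact: trace_sym_skew.
- by apply: from_bilinear_trace => b bP _ [_ _]; exact.
- by apply: from_bilinear_trace => b bP _ [bs _]; exact: trace_sym_skew.
- apply: from_bilinear_trace => b bP b0 [bs bphi]; apply: big1 => u _.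
  by apply: C10_diag => // x; have [] := b0 x.
- case=> -[aT _] aE; apply: trace_pointwise => u.
  by rewrite aE (acm_phi_reeb SP) trilinear0m // mulr0 oppr0.
- case=> -[aT _] aE; have [/(_ xi xi)/scalar_linear[f fE] _ _] := aT.
  rewrite -[RHS](C12_trace f eO); apply: eq_bigr => u _.
  have /= <- := congr1 (@^~ (ph u)) fE.
  by rewrite aE eta_phi (acm_unit SP) mulr1 mulr0 mul0r addr0.
Qed.

Lemma D1_trace e a : D1 S a -> reeb_trace e a = 0.
Proof. by move=> aD; apply: trace_pointwise => u; exact: D1_reeb. Qed.

Lemma CG_sum_trace s e a :
  orthonormal_basis g e -> {subset s <= [:: 1; 2; 3; 4; 6; 7; 8; 9; 10; 11; 12]%N} ->
  CG_sum S s a -> reeb_trace e a = 0.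
Proof.
move=> eO sS [b [bC aE]].
rewrite /reeb_trace (eq_bigr (fun u => \sum_(i <- s) b i u xi (ph u))) => [|u _ //].
rewrite exchange_big big_seq big1// => i si.
exact: (CG_trace eO (sS _ si) (bC _ si)).
Qed.

End AlmostContact.

(** * The cross product of R^7 *)

Section StandardG2.
Context {R : realType}.
Implicit Types (x y z : 'rV[R]_7).

Definition dot x y : R := \sum_(i < 7) x 0 i * y 0 i.

Lemma covecE (i : 'I_7) x : x 0 i = covec i.+1 x.
Proof. by rewrite /covec inord_val. Qed.

Lemma dotE x y : dot x y = covec 1 x * covec 1 y + covec 2 x * covec 2 y
  + covec 3 x * covec 3 y + covec 4 x * covec 4 y + covec 5 x * covec 5 y
  + covec 6 x * covec 6 y + covec 7 x * covec 7 y.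
Proof.
rewrite /dot; under eq_bigr => i _ do rewrite !covecE.
by rewrite !big_ord_recl big_ord0 /= !addrA addr0.
Qed.

Lemma wedge3E i j k x y z : wedge3 i j k x y z =
  covec i x * (covec j y * covec k z - covec k y * covec j z)
  - covec j x * (covec i y * covec k z - covec k y * covec i z)
  + covec k x * (covec i y * covec j z - covec j y * covec i z).
Proof.
rewrite /wedge3 (expand_det_row _ ord0) !big_ord_recl big_ord0 /cofactor.
rewrite !(expand_det_row _ ord0) !big_ord_recl !big_ord0 /cofactor !det_mx11 !mxE /=.
rewrite /bump /=.
ring.
Qed.

Definition minor2 x y (i j : nat) : R :=
  covec i x * covec j y - covec j x * covec i y.

(** The entries are the coefficients of [z_1, ..., z_7] in [phi0 x y z]. *)
Definition cross_coords x y : seq R :=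
  let m := minor2 x y in
  [:: m 2%N 3%N + m 4%N 5%N + m 6%N 7%N;
      m 3%N 1%N + m 4%N 6%N - m 5%N 7%N;
      m 1%N 2%N - m 4%N 7%N - m 5%N 6%N;
      m 5%N 1%N + m 6%N 2%N - m 7%N 3%N;
      m 1%N 4%N - m 7%N 2%N - m 6%N 3%N;
      m 7%N 1%N + m 2%N 4%N - m 3%N 5%N;
      m 1%N 6%N - m 2%N 5%N - m 3%N 4%N].

Definition cross0 x y : 'rV[R]_7 := \row_i (cross_coords x y)`_i.

Lemma cross0E i x y : (i < 7)%N -> covec i.+1 (cross0 x y) = (cross_coords x y)`_i.
Proof. by move=> i7; rewrite /covec mxE inordK. Qed.

Lemma phi0_cross0 x y z : phi0 x y z = dot (cross0 x y) z.
Proof. rewrite /phi0 !wedge3E dotE !cross0E// /= /minor2; ring. Qed.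

Lemma cross0_self x : cross0 x x = 0.
Proof.
apply/rowP => i; rewrite !mxE.
by case: i => -[|[|[|[|[|[|[|//]]]]]]] ?; rewrite /= /minor2; ring.
Qed.

Lemma cross0_sqr x y :
  cross0 x (cross0 x y) = - (dot x x *: y) + dot x y *: x.
Proof.
apply/rowP => i; rewrite [LHS]mxE !mxE !dotE /cross_coords /minor2 !cross0E// /= !covecE.
by case: i => -[|[|[|[|[|[|[|//]]]]]]] ?; rewrite /= /minor2; ring.
Qed.

Lemma phi0_skew x y z : phi0 x y z = - phi0 x z y.
Proof. rewrite /phi0 !wedge3E; ring. Qed.

Lemma phi0_cycle x y z : phi0 x y z = phi0 y z x.
Proof. rewrite /phi0 !wedge3E; ring. Qed.

Lemma dot_sym x y : dot x y = dot y x.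
Proof. by apply: eq_bigr => i _; rewrite mulrC. Qed.

Lemma dot_scalar x : scalar (dot x).
Proof.
move=> a y z; rewrite /dot mulr_sumr -big_split; apply: eq_bigr => i _ /=.
by rewrite !mxE mulrDr mulrCA.
Qed.

Lemma dot_delta x i : dot x (delta_mx 0 i) = x 0 i.
Proof.
rewrite /dot (bigD1 i)//= mxE !eqxx mulr1 big1 ?addr0// => j ji.
by rewrite mxE (negPf ji) mulr0.
Qed.

Lemma dot_nondegenerate x y : (forall z, dot x z = dot y z) -> x = y.
Proof. by move=> xy; apply/rowP => i; rewrite -!dot_delta. Qed.

Lemma dot_eq0 x : dot x x = 0 -> x = 0.
Proof.
move=> /eqP; rewrite /dot psumr_eq0 => [/allP x0|i _]; last exact: sqr_ge0.
apply/rowP => i; apply/eqP.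
by have := x0 i (mem_index_enum i); rewrite mxE /= mulf_eq0 orbb.
Qed.

End StandardG2.

(** * The almost contact metric structure of a G2 structure *)

Section G2Structure.
Context {R : realType} {M : manifold R 7} {vphi : field3 M}.
Hypothesis vphiP : g2_structure vphi.
Implicit Types (p q : M).

Lemma coframe_adapted p : adapted vphi (coframe vphi p).
Proof.
by have [_ /(_ p)] := vphiP; exact: xgetPex.
Qed.

Lemma coframe_inj p : injective (coframe vphi p).
Proof. by have [/bij_inj] := coframe_adapted p. Qed.

Lemma coframe_surj p y : exists x, coframe vphi p x = y.
Proof. by have [[h _ hK] _] := coframe_adapted p; exists (h y). Qed.

Lemma vphiE p x y z :
  vphi x y z = phi0 (coframe vphi p x) (coframe vphi p y) (coframe vphi p z).
Proof. by have [_ ->] := coframe_adapted p. Qed.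

Lemma g2_metricE p x y :
  g2_metric vphi x y = dot (coframe vphi p x) (coframe vphi p y).
Proof. by []. Qed.

Lemma g2_metric_sym p (x y : tangent p) : g2_metric vphi x y = g2_metric vphi y x.
Proof. exact: dot_sym. Qed.

Lemma g2_metric_bilinear p : bilinear_form (@g2_metric R M vphi p).
Proof.
have lin x : scalar (@g2_metric R M vphi p x).
  by move=> a y z; rewrite !g2_metricE linearP; exact: dot_scalar.
split=> // y a x z; rewrite ![g2_metric _ _ y]g2_metric_sym; exact: lin.
Qed.

Lemma g2_metric_eq0 p (x : tangent p) : g2_metric vphi x x = 0 -> x = 0.
Proof. by move=> /dot_eq0 x0; apply: coframe_inj; rewrite x0 linear0. Qed.

(** An adapted isomorphism carries the cross product to that of R^7, so algebraic
    identities need only be checked there. *)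
Lemma coframe_cross p x y : coframe vphi p (cross vphi x y) =
  cross0 (coframe vphi p x) (coframe vphi p y).
Proof.
have [w0 w0E] := coframe_surj p (cross0 (coframe vphi p x) (coframe vphi p y)).
have crossP : forall z, vphi x y z = g2_metric vphi (cross vphi x y) z.
  apply: (@xgetPex _ _ [set w | forall z, vphi x y z = g2_metric vphi w z]).
  by exists w0 => z /=; rewrite vphiE phi0_cross0 g2_metricE w0E.
apply: dot_nondegenerate => z'; have [z <-] := coframe_surj p z'.
by rewrite -phi0_cross0 -vphiE crossP.
Qed.

Lemma vphi_cross p (x y z : tangent p) :
  vphi x y z = g2_metric vphi (cross vphi x y) z.
Proof. by rewrite vphiE phi0_cross0 -coframe_cross. Qed.

Lemma vphi_skew p (x y z : tangent p) : vphi x y z = - vphi x z y.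
Proof. by rewrite !vphiE phi0_skew. Qed.

Lemma vphi_self p (x y : tangent p) : vphi x y x = 0.
Proof.
rewrite vphiE -phi0_cycle phi0_cross0 cross0_self /dot big1// => i _.
by rewrite mxE mul0r.
Qed.

Lemma g2_orthonormal_basis p :
  exists e, orthonormal_basis (@g2_metric R M vphi p) e.
Proof.
have [h hK Kh] : bijective (coframe vphi p) by have [] := coframe_adapted p.
pose e : seq (tangent p) := [seq h (delta_mx 0 i) | i <- enum 'I_7].
have eE (i : 'I_7) : e`_i = h (delta_mx 0 i).
  by rewrite (nth_map i) ?size_enum_ord// nth_ord_enum.
have se : size e = 7%N by rewrite size_map size_enum_ord.
exists e; apply: orthonormal_is_basis; first exact: g2_metric_bilinear.
  by rewrite se dimvf /dim /=.
rewrite se => i j i7 j7.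
rewrite (eE (Ordinal i7)) (eE (Ordinal j7)) g2_metricE !Kh dot_delta mxE eqxx /=.
by rewrite eq_sym.
Qed.

Section Field.
Variable xi : vfield M.
Hypothesis xiP : unit_vfield vphi xi.

Lemma g2_acm_almost_contact p : almost_contact_metric (g2_acm vphi xi p).
Proof.
have bP := g2_metric_bilinear p; have [_ /(_ p) xi1] := xiP.
split=> //=.
- exact: g2_metric_sym.
- move=> x y; rewrite ![g2_metric _ _ (cross _ _ _)]g2_metric_sym -!vphi_cross.
  exact: vphi_skew.
- move=> x; apply: coframe_inj.
  by rewrite !coframe_cross cross0_sqr -!g2_metricE xi1 scale1r linearD linearN linearZ.
- by apply: coframe_inj; rewrite coframe_cross cross0_self linear0.
Qed.

Section LeviCivita.
Variable nabla : cov_deriv M.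
Hypothesis nablaP : levi_civita (@g2_metric R M vphi) nabla.
Arguments nabla : clear implicits.

(** Half the derivative of the constant function [g(xi, xi)]. *)
Lemma nabla_orthogonal p (x : tangent p) : g2_metric vphi (xi p) (nabla p x xi) = 0.
Proof.
have [_ _ /(_ p x xi xi)] := nablaP; have [xiS xi1] := xiP.
move=> /(_ (xiS p) (xiS p)).
rewrite (_ : (fun q => _) = fun=> 1); last exact/funext.
by rewrite dir_cst [g2_metric _ (nabla _ _ _) _]g2_metric_sym; lra.
Qed.

Local Notation nablaPhi :=
  (nabla_field2 nabla (fun q => fundamental_form (g2_acm vphi xi q))).

(** Tensoriality of the covariant derivative of [L = vphi(xi, Z, .)] replaces the
    constant extension of [xi p] by the field [xi], on which [L] vanishes. *)
Lemma nablaPhi_reeb p (x z : tangent p) :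
  nablaPhi p x (xi p) z = - vphi (xi p) z (nabla p x xi).
Proof.
have [nablaC _ _] := nablaP; have [xiS xi1] := xiP; have [vphiS _] := vphiP.
pose L q (v : tangent q) := vphi (xi q) (extend z q) v.
have PhiE q y w : fundamental_form (g2_acm vphi xi q) y w = vphi (xi q) w y.
  by rewrite /fundamental_form /= g2_metric_sym vphi_cross.
have linL q : scalar (@L q).
  have [lin _] := g2_metric_bilinear q.
  by move=> a u v; rewrite /L !vphi_cross; exact: lin.
have smoothL Z : smooth_vf Z p -> smooth_fun (fun q => L q (Z q)) p.
  by move=> sZ; apply: vphiS => //; exact: smooth_extend.
have := nabla_form_tensorial nablaC x linL smoothL (smooth_extend (xi p))
  (xiS p) (extend_at _).
rewrite (_ : (fun q => L q (xi q)) = fun=> 0); last first.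
  by apply/funext => q; exact: vphi_self.
rewrite dir_cst sub0r /L extend_at => <-.
rewrite /nabla_field2 !PhiE vphi_self subr0; congr (dir x _ - _).
by apply/funext => q; rewrite PhiE.
Qed.

Lemma divergence_orthonormal p e : orthonormal_basis (@g2_metric R M vphi p) e ->
  divergence nabla xi p = \sum_(u <- e) g2_metric vphi u (nabla p u xi).
Proof.
move=> eO; apply: trace_orthonormal => //; first exact: g2_metric_bilinear.
have [[nablaL _ _ _] _ _] := nablaP; have [xiS _] := xiP.
by move=> a x y; exact: nablaL.
Qed.

(** Here [a(u, xi, phi u) = - g(phi (phi u), nabla_u xi)], and [- phi^2] is the
    identity modulo [xi], to which [nabla_u xi] is orthogonal. *)
Lemma reeb_trace_divergence p e : orthonormal_basis (@g2_metric R M vphi p) e ->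
  reeb_trace (g2_acm vphi xi p) e (nablaPhi p) = divergence nabla xi p.
Proof.
move=> eO; rewrite (divergence_orthonormal eO); apply: eq_bigr => u _.
have SP := g2_acm_almost_contact p; have bP := g2_metric_bilinear p.
rewrite nablaPhi_reeb vphi_cross g2_metric_sym [cross _ _ _](acm_sqr SP) /=.
rewrite (bilinDr bP) (bilinNr bP) (bilinZr bP) [g2_metric _ _ (xi p)]g2_metric_sym.
by rewrite nabla_orthogonal mulr0 addr0 opprK g2_metric_sym.
Qed.

(** For [v = nabla_xi xi], the value [a(xi, xi, phi v)] is [g(v, v)]. *)
Lemma reeb_geodesic p : (forall z, nablaPhi p (xi p) (xi p) z = 0) ->
  nabla p (xi p) xi = 0.
Proof.
move=> n0; set v := nabla p (xi p) xi; apply: g2_metric_eq0.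
have SP := g2_acm_almost_contact p; have bP := g2_metric_bilinear p.
have := n0 (cross vphi (xi p) v).
rewrite nablaPhi_reeb vphi_cross g2_metric_sym [cross _ _ _](acm_sqr SP) /= -/v.
rewrite (bilinDr bP) (bilinNr bP) (bilinZr bP) [g2_metric _ _ (xi p)]g2_metric_sym.
by rewrite nabla_orthogonal mulr0 addr0 opprK.
Qed.

End LeviCivita.
End Field.
End G2Structure.

(** * The classes excluded by the geodesic curvature and the divergence of xi *)

Theorem theorem1 (R : realType) (M : manifold R 7) (vphi : field3 M)
    (xi : vfield M) (nabla : cov_deriv M) :
  g2_structure vphi -> unit_vfield vphi xi ->
  levi_civita (g2_metric vphi) nabla ->
  ((exists p : M, nabla p (xi p) xi <> 0) ->
     ~ acm_in_class vphi xi nabla (fun p => @D2 R (tangent p)) /\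
     forall i : nat, (1 <= i <= 11)%N ->
       ~ acm_in_class vphi xi nabla (fun p S => CG S i))
  /\
  ((exists p : M, divergence nabla xi p <> 0) ->
     [/\ ~ acm_in_class vphi xi nabla (fun p => @D1 R (tangent p)),
         forall i : nat, i \in [:: 1; 2; 3; 4; 6; 7; 8; 9; 10; 11; 12]%N ->
           ~ acm_in_class vphi xi nabla (fun p S => CG S i) &
         ~ acm_in_class vphi xi nabla
             (fun p S => CG_sum S [:: 1; 2; 3; 7; 8; 9; 10; 11]%N)]).
Proof.
move=> vphiP xiP nablaP.
have acmP := g2_acm_almost_contact vphiP xiP.
split=> -[p pN].
  split=> [inD2|i iI inC]; apply: pN; apply: (reeb_geodesic vphiP xiP nablaP) => z.
  - exact: (D2_reeb (acmP p) _ (inD2 p)).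
  - exact: (CG_reeb (acmP p) _ iI (inC p)).
have [e eO] := g2_orthonormal_basis vphiP p.
have traceE := reeb_trace_divergence vphiP xiP nablaP eO.
split=> [inD1|i iI inC|inS]; apply: pN; rewrite -traceE.
- exact: D1_trace (inD1 p).
- exact: (CG_trace (acmP p) eO iI (inC p)).
- by apply: (CG_sum_trace (acmP p) eO _ (inS p)); exact/allP.
Qed.
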